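(* Let $R$ be a prime ring which is a maximal subring of a ring $T$. Let $\mathcal{A}$ be the set of all nonzero ideals $I$ of $T$ such that $R\cap I=0$. Then $|\mathcal{A}|\leq 2$. In fact, $|\mathcal{A}|=2$ if and only if there exists a minimal ideal $A$ of $R$ such that $T\cong \Delta(R)+(A\times A)$, where the latter is regarded as a subring of $R\times R$. Moreover, in this case $Min_T(0)=\mathcal{A}$ and $(R:T)=(R:T)_l=(R:T)_r=0$.
   Context: All rings are associative and unital (not necessarily commutative), and subrings contain the identity of the big ring; ''ideal'' means two-sided ideal, and a minimal ideal is a minimal nonzero ideal. A maximal subring $R$ of $T$ is a proper subring with no subring strictly between $R$ and $T$. $\Delta(R)=\{(r,r): r\in R\}$ is the diagonal subring of $R\times R$. Conductors: $(R:T)=\{x\in T: TxT\subseteq R\}$, $(R:T)_l=\{x\in T: Tx\subseteq R\}$, $(R:T)_r=\{x\in T: xT\subseteq R\}$. $Min_T(0)$ is the set of all minimal prime ideals of $T$.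
   Formalization: The isomorphism T ≅ Δ(R)+(A×A) is required to send each r in the subring R of T to (r,r); for a bare ring isomorphism the ''if'' direction is false, since Δ(R)+(A×A) can contain another maximal subring isomorphic to R. *)

(* Defs.v *)
From HB Require Import structures.
From mathcomp Require Import all_boot all_order all_algebra.
From mathcomp Require Import boolp classical_sets functions cardinality.

Set Implicit Arguments.
Unset Strict Implicit.
Unset Printing Implicit Defensive.

Import GRing.Theory.
Local Open Scope classical_set_scope.
Local Open Scope ring_scope.

Section RingNotions.
Variable T : pzRingType.
Implicit Types (R U I J P A B : set T).

(* [GRing.subring_closed] includes 1 \in U. *)
Definition subring U : Prop := GRing.subring_closed [in U].

Definition maximal_subring R : Prop :=
  [/\ subring R, R <> setT &
      forall U, subring U -> R `<=` U -> U = R \/ U = setT].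

Definition two_sided_ideal I : Prop :=
  [/\ I 0, forall x y, I x -> I y -> I (x - y) &
      forall a x, I x -> I (a * x) /\ I (x * a)].

Definition minimal_ideal A : Prop :=
  [/\ two_sided_ideal A, A <> [set 0] &
      forall B, two_sided_ideal B -> B <> [set 0] -> B `<=` A -> B = A].

(* The inclusion I J `<=` P is tested on products of elements, which generate
   the ideal product I J additively. *)
Definition prime_ideal P : Prop :=
  [/\ two_sided_ideal P, P <> setT &
      forall I J, two_sided_ideal I -> two_sided_ideal J ->
        (forall x y, I x -> J y -> P (x * y)) -> I `<=` P \/ J `<=` P].

(* In particular the zero ring is not prime. *)
Definition prime_ring : Prop := prime_ideal [set 0].

Definition minimal_primes : set (set T) :=
  [set P | prime_ideal P /\
     forall Q : set T, prime_ideal Q -> Q `<=` P -> Q = P].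

Definition conductor R : set T := [set x | forall s t, R (s * x * t)].
Definition conductor_l R : set T := [set x | forall t, R (t * x)].
Definition conductor_r R : set T := [set x | forall t, R (x * t)].

Definition trivial_trace_ideals R : set (set T) :=
  [set I | [/\ two_sided_ideal I, I <> [set 0] & R `&` I = [set 0]]].

End RingNotions.

Arguments prime_ring T : clear implicits.
Arguments minimal_primes T : clear implicits.

Definition diagonal_subring (R : pzRingType) : set (R * R) :=
  range (fun r : R => (r, r)).
Arguments diagonal_subring R : clear implicits.

Definition diagonal_plus (R : pzRingType) (A : set R) : set (R * R) :=
  [set d + p | d in diagonal_subring R & p in A `*` A].

Lemma diagonal_plus_subring (R : pzRingType) (A : set R) :
  two_sided_ideal A -> subring (diagonal_plus A).
Proof.
move=> [A0 AB AM].
have AN x : A x -> A (- x) by move=> Ax; rewrite -sub0r; exact: AB.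
have AD x y : A x -> A y -> A (x + y).
  by move=> Ax Ay; rewrite -[y]opprK; apply: AB => //; exact: AN.
split.
- rewrite inE; exists (1, 1); first by exists 1.
  by exists (0, 0); [|exact: addr0].
- move=> x y /[!inE] -[_ [r _ <-] [[a b] [/= Aa Ab] <-]].
  move=> [_ [s _ <-] [[c d] [/= Ac Ad] <-]].
  exists (r - s, r - s); first by exists (r - s).
  exists (a - c, b - d); first by split; exact: AB.
  by congr pair => /=; rewrite opprD addrACA.
- move=> x y /[!inE] -[_ [r _ <-] [[a b] [/= Aa Ab] <-]].
  move=> [_ [s _ <-] [[c d] [/= Ac Ad] <-]].
  exists (r * s, r * s); first by exists (r * s).
  exists (r * c + a * (s + c), r * d + b * (s + d)).
    split=> /=; apply: AD; by [case: (AM r c Ac)|case: (AM (s + c) a Aa)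
      |case: (AM r d Ad)|case: (AM (s + d) b Ab)].
  by congr pair => /=; rewrite addrA -mulrDr -mulrDl.
Qed.

(* Isomorphisms T ~ Delta(R) + (A x A), for R a subring of T with inclusion
   [val], given as embeddings of T into R * R with that image.  They are
   isomorphisms of extensions of R: the subring R of T has to correspond to the
   diagonal.  For bare ring isomorphisms the characterization of two trivially
   intersecting ideals fails, since Delta(R) + (A x A) can contain another
   maximal subring isomorphic to R. *)
Definition iso_diagonal_plus (T : pzRingType) (S : {pred T})
    (R : subPzRingType S) (A : set R) : Prop :=
  exists f : {rmorphism T -> (R * R)%type},
    [/\ injective f, range f = diagonal_plus A &
        forall r : R, f (val r) = (r, r)].

(* Main.v *)
(* If I and J are distinct nonzero ideals of T meeting R trivially, maximality
   of R gives T = R + I = R + J, so I and J are kernels of retractions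
   p, q : T -> R and hence prime; by the modular law they are incomparable and
   meet in 0.  A third such ideal would contain I J = 0, hence I or J.  The map
   (p, q) embeds T in R x R as Delta(R) + (A x A) with A = R :&: (I + J), and A
   is minimal because an ideal 0 < B < A would give the intermediate ring
   {t | p t - q t \in B}. *)
Require Import Defs.
From HB Require Import structures.
From mathcomp Require Import all_boot all_order all_algebra.
From mathcomp Require Import boolp classical_sets functions cardinality.

Set Implicit Arguments.
Unset Strict Implicit.
Unset Printing Implicit Defensive.

Import GRing.Theory.
Local Open Scope classical_set_scope.
Local Open Scope ring_scope.

(** * Sets with two elements, or at most two *)

Lemma card_eq_I2P (U : pointedType) (A : set U) :
  (A #= `I_2)%card <-> exists x y, x <> y /\ A = [set x; y].
Proof.
split=> [|[x [y [xy ->]]]].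
  rewrite card_eq_sym => /card_set_bijP[f [fA finj fsurj]].
  exists (f 0%N), (f 1%N); split.
    by move=> /finj; rewrite !inE => /(_ isT isT).
  apply/seteqP; split=> [z /fsurj[[|[|//]] _ <-]|z [] ->].
  - by left.
  - by right.
  - exact: fA.
  - exact: fA.
pose f n := if n is 0%N then x else y.
have <- : f @` `I_2 = [set x; y].
  apply/seteqP; split=> [_ [[|[|//]] _ <-]|_ [] ->]; [by left|by right| |].
  - by exists 0%N.
  - by exists 1%N.
apply: inj_card_eq => -[|[|n]] [|[|m]] //; rewrite ?inE //= => _ _.
by move/esym.
Qed.

(** Once two distinct elements are fixed, every third one equals one of them, so the set is a pair;
    otherwise it has at most one element. *)
Lemma card_le_I2 (U : pointedType) (A : set U) :
  (forall x y z, A x -> A y -> A z -> [\/ x = y, x = z | y = z]) ->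
  (A #<= `I_2)%card.
Proof.
move=> A3; have [[x [y [Ax Ay xy]]]|Asub] :=
  pselect (exists x y, [/\ A x, A y & x <> y]).
  suff : (A #= `I_2)%card by rewrite card_eq_le => /andP[].
  apply/card_eq_I2P; exists x, y; split=> //.
  apply/seteqP; split=> [z Az|z [] -> //].
  by have [//|->|->] := A3 x y z Ax Ay Az; [left|right].
have [->|/set0P[x Ax]] := eqVneq A set0; first exact: card_ge0.
have : (A #<= [set x])%card.
  apply: subset_card_le => y Ay; apply: contrapT => yx.
  by apply: Asub; exists y, x.
move/card_le_trans; apply.
rewrite (card_le_eql card_set1); apply: subset_card_le => n /=.
exact: leq_trans.
Qed.

(** * Ideals, primes and annihilators *)

Section Ideals.
Variable T : pzRingType.
Implicit Types I J A P : set T.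

Lemma two_sided_idealN I x : two_sided_ideal I -> I x -> I (- x).
Proof. by move=> [I0 IB _] Ix; rewrite -sub0r; apply: IB. Qed.

Lemma two_sided_idealD I x y : two_sided_ideal I -> I x -> I y -> I (x + y).
Proof.
move=> idI Ix Iy; rewrite -[y]opprK; case: (idI) => _ + _; apply=> //.
exact: two_sided_idealN.
Qed.

Lemma nonzero_ideal_ex I :
  two_sided_ideal I -> I <> [set 0] -> exists2 x, I x & x <> 0.
Proof.
move=> [I0 _ _] In0; apply: contrapT => nex; apply: In0.
apply/seteqP; split=> [x Ix|_ -> //]; apply: contrapT => xn0.
by apply: nex; exists x.
Qed.

(** A product of an element of [I] by one of [J] lies in both ideals, hence is 0 and belongs to
    [P]. *)
Lemma prime_ideal_disjoint I J P :
  two_sided_ideal I -> two_sided_ideal J -> I `&` J `<=` [set 0] ->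
  prime_ideal P -> I `<=` P \/ J `<=` P.
Proof.
move=> idI idJ IJ [[P0 _ _] _ Pprime]; apply: Pprime => // x y Ix Jy.
rewrite (IJ (x * y)) //; case: idI idJ => _ _ IM [_ _ JM].
by split; [case: (IM y x Ix)|case: (JM x y Jy)].
Qed.

(** The right annihilator [B] of [A] is a two-sided ideal because [A] absorbs multiplication on the
    right. As [A B = 0] and [A] is nonzero, primeness forces [B = 0]. *)
Lemma prime_ring_annr A x : prime_ring T -> two_sided_ideal A ->
  A <> [set 0] -> (forall a, A a -> a * x = 0) -> x = 0.
Proof.
move=> [_ _ primeT] idA An0 Ax.
have [a Aa an0] := nonzero_ideal_ex idA An0.
pose B := [set y | forall b, A b -> b * y = 0].
have idB : two_sided_ideal B.
  case: idA => _ _ AM; split=> [b _|y z By Bz b Ab|c y By].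
  - by rewrite mulr0.
  - by rewrite mulrBr By // Bz // subrr.
  - split=> b Ab; last by rewrite mulrA By // mul0r.
    by rewrite mulrA By //; case: (AM c b Ab).
have [b y Ab By|/(_ a Aa)|/(_ x Ax)] // := primeT A B idA idB.
exact: By.
Qed.

Lemma prime_ring_annl A x : prime_ring T -> two_sided_ideal A ->
  A <> [set 0] -> (forall a, A a -> x * a = 0) -> x = 0.
Proof.
move=> [_ _ primeT] idA An0 Ax.
have [a Aa an0] := nonzero_ideal_ex idA An0.
pose B := [set y | forall b, A b -> y * b = 0].
have idB : two_sided_ideal B.
  case: idA => _ _ AM; split=> [b _|y z By Bz b Ab|c y By].
  - by rewrite mul0r.
  - by rewrite mulrBl By // Bz // subrr.
  - split=> b Ab; first by rewrite -mulrA By // mulr0.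
    by rewrite -mulrA By //; case: (AM c b Ab).
by have [|/(_ x Ax)|/(_ a Aa)] := primeT B A idB idA; [move=> y b By /By|..].
Qed.

End Ideals.

(** * Transport of ideals and primeness along ring morphisms *)

Section Morphisms.
Variables (T R : pzRingType) (f : {rmorphism T -> R}).

Lemma preimage_ideal (I : set R) :
  two_sided_ideal I -> two_sided_ideal (f @^-1` I).
Proof.
move=> [I0 IB IM]; split=> [|x y Ix Iy|a x Ix] /=.
- by rewrite rmorph0.
- by rewrite rmorphB; apply: IB.
- by rewrite !rmorphM; apply: IM.
Qed.

Hypothesis f_surj : forall r, exists t, f t = r.

Lemma image_ideal (I : set T) : two_sided_ideal I -> two_sided_ideal (f @` I).
Proof.
move=> [I0 IB IM]; split=> [|_ _ [x Ix <-] [y Iy <-]|a _ [x Ix <-]].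
- by exists 0; rewrite ?rmorph0.
- by exists (x - y); rewrite ?rmorphB //; apply: IB.
- have [b <-] := f_surj a; have [bx xb] := IM b x Ix.
  by split; [exists (b * x)|exists (x * b)]; rewrite ?rmorphM.
Qed.

(** Surjectivity makes images of ideals ideals again, so primeness of 0 in [R] can be applied to
    [f @] I[and]f @[J]. *)
Lemma prime_ideal_kernel : prime_ring R -> prime_ideal [set t | f t = 0].
Proof.
move=> [id0 ne primeR]; split=> [||I J idI idJ IJ].
- exact: (preimage_ideal id0).
- move=> kerT; apply: ne; apply/seteqP; split=> // r _.
  by have [t <-] := f_surj r; have : [set: T] t by []; rewrite -kerT.
- have [|||fI|fJ] := primeR (f @` I) (f @` J); first exact: image_ideal.
  + exact: image_ideal.
  + by move=> _ _ [x Ix <-] [y Jy <-]; rewrite -rmorphM; apply: IJ.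
  + by left=> x Ix; apply: fI; exists x.
  + by right=> x Jx; apply: fJ; exists x.
Qed.

End Morphisms.

(** * The morphism into a product given by two morphisms *)

Section PairMorphism.
Variables (T R1 R2 : pzRingType).
Variables (f1 : {rmorphism T -> R1}) (f2 : {rmorphism T -> R2}).

Definition pair_map t : R1 * R2 := (f1 t, f2 t).

Fact pair_map_is_zmod_morphism : zmod_morphism pair_map.
Proof. by move=> x y; rewrite /pair_map !rmorphB. Qed.

Fact pair_map_is_monoid_morphism : monoid_morphism pair_map.
Proof. by split=> [|x y]; rewrite /pair_map ?rmorph1 ?rmorphM. Qed.

HB.instance Definition _ := GRing.isZmodMorphism.Build T (R1 * R2)%type
  pair_map pair_map_is_zmod_morphism.
HB.instance Definition _ := GRing.isMonoidMorphism.Build T (R1 * R2)%type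
  pair_map pair_map_is_monoid_morphism.

End PairMorphism.

(** * Ideals meeting a prime maximal subring trivially *)

Section MaximalSubring.
Variables (T : pzRingType) (S : {pred T}) (R : subPzRingType S).
Hypotheses (primeR : prime_ring R) (maxR : maximal_subring [set` S]).
Implicit Types I J P : set T.

Local Notation tt := (trivial_trace_ideals [set` S]).

Lemma trivial_trace_val I (r : R) : tt I -> I (val r) -> r = 0.
Proof.
move=> [_ _ SI] Ir; apply: (@val_inj _ _ R); rewrite rmorph0.
have : ([set` S] `&` I) (val r) by split=> //; exact: (valP r).
by rewrite SI.
Qed.

(** The set [U] is [R + I], a subring containing [R]. If it were [R], then [I] would lie in [R] and
    so be 0; by maximality it is [T]. *)
Lemma trivial_trace_supplement I t : tt I -> exists r : R, I (t - val r).
Proof.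
move=> ttI; have [idI In0 _] := ttI; have [I0 IB IM] := idI.
pose U := [set t | exists r : R, I (t - val r)].
change (U t).
have [_ _ /(_ U)] := maxR; case.
- split=> [|x y /[!inE] -[r Ir] [s Is]|x y /[!inE] -[r Ir] [s Is]].
  + by rewrite inE; exists 1; rewrite rmorph1 subrr.
  + exists (r - s).
    have -> : x - y - val (r - s) = (x - val r) - (y - val s).
      by rewrite rmorphB !opprD addrACA.
    exact: IB.
  + exists (r * s); rewrite rmorphM.
    have -> : x * y - val r * val s = (x - val r) * y + val r * (y - val s).
      by rewrite mulrBl mulrBr addrA subrK.
    apply: two_sided_idealD => //.
      by case: (IM y _ Ir).
    by case: (IM (val r) _ Is).
- by move=> x /= Sx; exists (Sub x Sx); rewrite SubK subrr.
- move=> US; have [x Ix xn0] := nonzero_ideal_ex idI In0.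
  have Sx : x \in S.
    suff : U x by rewrite US.
    by exists 0; rewrite rmorph0 subr0.
  case: xn0; rewrite -(SubK R Sx) (@trivial_trace_val I (Sub x Sx)) ?rmorph0 //.
  by rewrite SubK.
- by move=> ->.
Qed.

Lemma trivial_trace_retraction I : tt I ->
  exists p : {rmorphism T -> R},
    (forall r, p (val r) = r) /\ I = [set t | p t = 0].
Proof.
move=> ttI; have [idI _ _] := ttI; have [I0 IB IM] := idI.
have [p Ip] := choice (fun t => trivial_trace_supplement t ttI).
(* The component in [R] is unique: two candidates differ by an element of [R] and [I]. All the
   morphism laws for the choice function [p] follow from this. *)
have pE t r : I (t - val r) -> p t = r.
  move=> Ir; apply/eqP; rewrite -subr_eq0; apply/eqP.
  apply: (trivial_trace_val ttI).
  have -> : val (p t - r) = (t - val r) - (t - val (p t)).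
    by rewrite rmorphB opprB [RHS]addrC subrKA.
  exact: IB.
have pB : zmod_morphism p.
  move=> x y; apply: pE.
  have -> : x - y - val (p x - p y) = (x - val (p x)) - (y - val (p y)).
    by rewrite rmorphB !opprD addrACA.
  exact: IB.
have pM : monoid_morphism p.
  split=> [|x y]; apply: pE; first by rewrite rmorph1 subrr.
  have -> : x * y - val (p x * p y) =
      (x - val (p x)) * y + val (p x) * (y - val (p y)).
    by rewrite rmorphM mulrBl mulrBr addrA subrK.
  apply: two_sided_idealD => //.
    by case: (IM y _ (Ip x)).
  by case: (IM (val (p x)) _ (Ip y)).
pose p' : {rmorphism T -> R} := HB.pack p (GRing.isZmodMorphism.Build T R p pB)
  (GRing.isMonoidMorphism.Build T R p pM).
exists p'; split=> [r|]; first by apply: pE; rewrite subrr.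
apply/seteqP; split=> t /= It; first by apply: pE; rewrite rmorph0 subr0.
by have := Ip t; rewrite It rmorph0 subr0.
Qed.

Lemma trivial_trace_prime I : tt I -> prime_ideal I.
Proof.
move=> /trivial_trace_retraction[p [pK ->]].
by apply: prime_ideal_kernel => // r; exists (val r).
Qed.

(** Modular law: write [x] in [J] as an element [r] of [R] plus one of [I]; then [r] lies in [J]
    too, so it is 0. *)
Lemma trivial_trace_sub_eq I J : tt I -> tt J -> I `<=` J -> I = J.
Proof.
move=> ttI ttJ IJ; apply/seteqP; split=> // x Jx.
have [r Ir] := trivial_trace_supplement x ttI.
have [idJ _ _] := ttJ; have [_ JB _] := idJ.
suff r0 : r = 0 by rewrite r0 rmorph0 subr0 in Ir.
by apply: (trivial_trace_val ttJ); rewrite -[val r](subKr x); apply/JB/IJ.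
Qed.

Lemma trivial_trace_disjoint I J :
  tt I -> tt J -> I <> J -> I `&` J `<=` [set 0].
Proof.
move=> ttI ttJ IJ x [Ix Jx]; apply: contrapT => xn0; apply: IJ.
(* A nonzero intersection would itself meet [R] trivially and, being contained in both ideals, would
   equal both. *)
suff ttIJ : tt (I `&` J).
  apply: (@etrans _ _ (I `&` J)); last first.
    by apply: trivial_trace_sub_eq => // y [].
  by apply/esym/trivial_trace_sub_eq => // y [].
case: ttI ttJ => -[I0 IB IM] _ SI [[J0 JB JM] _ _]; split.
- split=> // [y z [Iy Jy] [Iz Jz]|a y [Iy Jy]].
    by split; [apply: IB|apply: JB].
  by have [] := IM a y Iy; have [] := JM a y Jy.
- by move=> IJ0; apply: xn0; suff : [set 0] x by []; rewrite -IJ0.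
- by rewrite setIA SI; apply/seteqP; split=> [y []|_ ->].
Qed.

Lemma trivial_trace_card_le : (tt #<= `I_2)%card.
Proof.
apply: card_le_I2 => I J K ttI ttJ ttK.
have [|IJ] := pselect (I = J); first by constructor 1.
have [idI _ _] := ttI; have [idJ _ _] := ttJ.
have [IK|JK] := prime_ideal_disjoint idI idJ (trivial_trace_disjoint ttI ttJ IJ)
  (trivial_trace_prime ttK).
- by constructor 2; apply: trivial_trace_sub_eq.
- by constructor 3; apply: trivial_trace_sub_eq.
Qed.

(** Since [I] and [J] meet in 0, every prime contains one of them; both are prime, and neither
    contains the other. *)
Lemma trivial_trace_minimal_primes I J :
  tt = [set I; J] -> I <> J -> minimal_primes T = tt.
Proof.
move=> ttE IJ.
have ttI : tt I by rewrite ttE; left.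
have ttJ : tt J by rewrite ttE; right.
have prime_sub P : prime_ideal P -> exists2 K, tt K & K `<=` P.
  case: (ttI) (ttJ) => idI _ _ [idJ _ _].
  by case/(prime_ideal_disjoint idI idJ (trivial_trace_disjoint ttI ttJ IJ));
    [exists I|exists J].
apply/seteqP; split=> [P [primeP minP]|K ttK].
  have [K ttK KP] := prime_sub P primeP.
  by rewrite -(minP K) //; exact: trivial_trace_prime.
split=> [|Q /prime_sub[L ttL LQ] QK]; first exact: trivial_trace_prime.
apply/seteqP; split=> //.
by rewrite -(trivial_trace_sub_eq ttL ttK (subset_trans LQ QK)).
Qed.

(** This is the intersection of [R] with [I + J], viewed inside the type [R]; it serves as the ideal
    [A] of the diagonal description. *)
Definition trace_sum I J : set R :=
  [set r | exists i j, [/\ I i, J j & val r = i + j]].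

Lemma trace_sum_ideal I J :
  two_sided_ideal I -> two_sided_ideal J -> two_sided_ideal (trace_sum I J).
Proof.
move=> [I0 IB IM] [J0 JB JM]; split.
- by exists 0, 0; rewrite rmorph0 addr0.
- move=> r s [i [j [Ii Jj rE]]] [k [l [Ik Jl sE]]].
  exists (i - k), (j - l); split; [exact: IB|exact: JB|].
  by rewrite rmorphB /= rE sE opprD addrACA.
- move=> a r [i [j [Ii Jj rE]]].
  have [ai ia] := IM (val a) i Ii; have [aj ja] := JM (val a) j Jj; split.
  + by exists (val a * i), (val a * j); rewrite rmorphM /= rE mulrDr.
  + by exists (i * val a), (j * val a); rewrite rmorphM /= rE mulrDl.
Qed.

(** * Consequences of two distinct ideals with trivial trace *)

Section TwoIdeals.
Variables (I J : set T).
Hypotheses (ttI : tt I) (ttJ : tt J) (IJ : I <> J).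

Local Notation A := (trace_sum I J).

(** Decompose a nonzero [i] of [I] along [T = R + J]. Its component in [R] lies in [A], and if it
    vanished, [i] would lie in both ideals. *)
Lemma trace_sum_neq0 : A <> [set 0].
Proof.
move=> A0; have [idI In0 _] := ttI; have [idJ _ _] := ttJ.
have [i Ii in0] := nonzero_ideal_ex idI In0.
have [r Jr] := trivial_trace_supplement i ttJ.
have : A r.
  exists i, (- (i - val r)); split=> //; first exact: two_sided_idealN.
  by rewrite opprB addrC subrK.
rewrite A0 => /= r0; rewrite r0 rmorph0 subr0 in Jr.
by apply/in0/(trivial_trace_disjoint ttI ttJ IJ); split.
Qed.

Lemma trace_sum_minimal : minimal_ideal A.
Proof.
have [idI _ _] := ttI; have [idJ _ _] := ttJ.
split; [exact: trace_sum_ideal|exact: trace_sum_neq0|].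
move=> B idB Bn0 BA; apply/seteqP; split=> // a Aa.
have [p [pK pE]] := trivial_trace_retraction ttI.
have [q [qK qE]] := trivial_trace_retraction ttJ.
(* The map [p - q] vanishes on [R], yet recovers each element of [A] from its [J]-part. *)
have diffJ i j r : I i -> J j -> val r = i + j -> p j - q j = r.
  by rewrite pE qE => /= pi qj rE; rewrite -(pK r) rE rmorphD pi qj add0r subr0.
have [B0 BB BM] := idB.
pose U := [set t | B (p t - q t)].
have [_ _ /(_ U)] := maxR; case.
- split=> [|x y /[!inE] Bx By|x y /[!inE] Bx By]; rewrite ?inE /U /=.
  + by rewrite !rmorph1 subrr.
  + have -> : p (x - y) - q (x - y) = (p x - q x) - (p y - q y).
      by rewrite !rmorphB !opprD addrACA.
    exact: BB.
  (* Twisted Leibniz rule: [p - q] is a derivation relative to [p] and [q], so [U] is closed under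
     products. *)
  + have -> : p (x * y) - q (x * y) = p x * (p y - q y) + (p x - q x) * q y.
      by rewrite !rmorphM mulrBr mulrBl addrA subrK.
    apply: two_sided_idealD => //.
      by case: (BM (p x) _ By).
    by case: (BM (q y) _ Bx).
- by move=> x /= Sx; rewrite /U /= -(SubK R Sx) pK qK subrr.
(* If [U = R], the [J]-part of a nonzero [b] in [B] lies in [R], where [p] and [q] agree, so
   [b = 0]. *)
- move=> US; have [b Bb bn0] := nonzero_ideal_ex idB Bn0.
  have [i [j [Ii Jj bE]]] := BA _ Bb.
  have Sj : j \in S.
    suff : U j by rewrite US.
    by rewrite /U /= (diffJ i j b).
  case: bn0; rewrite -(diffJ i j b) //.
  by rewrite -(SubK R Sj) pK qK subrr.
- move=> UT; have [i [j [Ii Jj aE]]] := Aa.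
  by rewrite -(diffJ i j a) // -[B _]/(U j) UT.
Qed.

Lemma trace_sum_iso : iso_diagonal_plus A.
Proof.
have [idI _ _] := ttI; have [idJ _ _] := ttJ.
have [p [pK pE]] := trivial_trace_retraction ttI.
have [q [qK qE]] := trivial_trace_retraction ttJ.
exists (pair_map p q); split=> [x y [pxy qxy]||r].
- apply/eqP; rewrite -subr_eq0; apply/eqP.
  apply: (trivial_trace_disjoint ttI ttJ IJ); rewrite pE qE; split=> /=.
    by rewrite rmorphB pxy subrr.
  by rewrite rmorphB qxy subrr.
- apply/seteqP; split=> [_ [t _ <-]|].
    exists (p t, p t); first by exists (p t).
    exists (0, q t - p t); last first.
      by congr pair => /=; rewrite ?addr0 // addrC subrK.
    split=> /=; first by case: (trace_sum_ideal idI idJ).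
    (* The difference [q t - p t] is the [I]-part of [t] minus its [J]-part, hence an element of
       [A]. *)
    exists (t - val (p t)), (- (t - val (q t))); split.
    + by rewrite pE /= rmorphB pK subrr.
    + by apply: two_sided_idealN => //; rewrite qE /= rmorphB qK subrr.
    + by rewrite rmorphB opprB [RHS]addrC subrKA.
  move=> _ [_ [r _ <-] [[a b] [/= [i [j [Ii Jj aE]]] [k [l [Ik Jl bE]]]] <-]].
  (* The target is [(r + a, r + b)] with [a = i + j] and [b = k + l]. Here [p] sends [j] to [a] and
     kills [k], while [q] sends [k] to [b] and kills [j]. *)
  exists (val r + (j + k)) => //.
  move: Ii Jj Ik Jl; rewrite pE qE /= => pi qj pk ql.
  congr pair => /=; rewrite !rmorphD /= ?pK ?qK; congr (_ + _).
    by rewrite pk addr0 -(pK a) aE rmorphD pi add0r.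
  by rewrite qj add0r -(qK b) bE rmorphD ql addr0.
- by congr pair; [exact: pK|exact: qK].
Qed.

(** If [T x] lies in [R], then [I x] and [J x] lie in [R] and in their ideals, so they vanish. Hence
    [A x = 0], and primeness of [R] gives [x = 0]. *)
Lemma conductor_l_eq0 : conductor_l [set` S] = [set 0].
Proof.
have [idI _ SI] := ttI; have [idJ _ SJ] := ttJ.
have [_ _ IM] := idI; have [_ _ JM] := idJ.
apply/seteqP; split=> [x Sx|_ -> t /=]; last first.
  by rewrite mulr0 -(rmorph0 (val : R -> T)); exact: valP.
have xS : x \in S by have := Sx 1; rewrite mul1r.
rewrite -(SubK R xS) (prime_ring_annr (x := Sub x xS) primeR
  (trace_sum_ideal idI idJ) trace_sum_neq0) ?rmorph0 //.
move=> a [i [j [Ii Jj aE]]]; apply: (@val_inj _ _ R).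
rewrite rmorphM rmorph0 /= aE SubK mulrDl.
have -> : i * x = 0.
  suff : ([set` S] `&` I) (i * x) by rewrite SI.
  by split; [exact: Sx|case: (IM x i Ii)].
have -> : j * x = 0.
  suff : ([set` S] `&` J) (j * x) by rewrite SJ.
  by split; [exact: Sx|case: (JM x j Jj)].
by rewrite addr0.
Qed.

Lemma conductor_r_eq0 : conductor_r [set` S] = [set 0].
Proof.
have [idI _ SI] := ttI; have [idJ _ SJ] := ttJ.
have [_ _ IM] := idI; have [_ _ JM] := idJ.
apply/seteqP; split=> [x Sx|_ -> t /=]; last first.
  by rewrite mul0r -(rmorph0 (val : R -> T)); exact: valP.
have xS : x \in S by have := Sx 1; rewrite mulr1.
rewrite -(SubK R xS) (prime_ring_annl (x := Sub x xS) primeR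
  (trace_sum_ideal idI idJ) trace_sum_neq0) ?rmorph0 //.
move=> a [i [j [Ii Jj aE]]]; apply: (@val_inj _ _ R).
rewrite rmorphM rmorph0 /= aE SubK mulrDr.
have -> : x * i = 0.
  suff : ([set` S] `&` I) (x * i) by rewrite SI.
  by split; [exact: Sx|case: (IM x i Ii)].
have -> : x * j = 0.
  suff : ([set` S] `&` J) (x * j) by rewrite SJ.
  by split; [exact: Sx|case: (JM x j Jj)].
by rewrite addr0.
Qed.

Lemma conductor_eq0 : conductor [set` S] = [set 0].
Proof.
apply/seteqP; split=> [x Sx|_ -> s t /=]; last first.
  by rewrite mulr0 mul0r -(rmorph0 (val : R -> T)); exact: valP.
(* Taking 1 as right factor places the two-sided conductor inside the left one. *)
by rewrite -conductor_l_eq0 => t; have := Sx t 1; rewrite mulr1.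
Qed.

End TwoIdeals.

(** The two ideals are the kernels of the coordinates of [f]. Both coordinates restrict to the
    identity on [R], so the kernels meet [R] trivially; the preimages of [(0, a)] and [(a, 0)] show
    that they are nonzero and distinct. *)
Lemma iso_diagonal_plus_card (A : set R) :
  two_sided_ideal A -> A <> [set 0] -> iso_diagonal_plus A ->
  (tt #= `I_2)%card.
Proof.
move=> idA An0 [f [finj frange fval]].
have [A0 _ _] := idA.
have [a Aa an0] := nonzero_ideal_ex idA An0.
have f_onto u v : A u -> A v -> exists t, f t = (u, v).
  move=> Au Av; suff : range f (u, v) by case=> t _ <-; exists t.
  rewrite frange; exists (0, 0); first by exists 0.
  by exists (u, v) => //; congr pair => /=; rewrite add0r.
have ideal_ker1 : two_sided_ideal [set t | (f t).1 = 0].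
  (* That [[set 0]] is an ideal of [R] is read off from [primeR]. *)
  by have := @preimage_ideal _ _ (fst \o f) [set 0]; apply; case: primeR.
have ideal_ker2 : two_sided_ideal [set t | (f t).2 = 0].
  by have := @preimage_ideal _ _ (snd \o f) [set 0]; apply; case: primeR.
have [t1 ft1] := f_onto 0 a A0 Aa.
have [t2 ft2] := f_onto a 0 Aa A0.
have S0 : 0 \in S by rewrite -(rmorph0 (val : R -> T)); exact: valP.
rewrite card_eq_le trivial_trace_card_le /=.
have tt1 : tt [set t | (f t).1 = 0].
  split=> // [E|].
    have : [set t | (f t).1 = 0] t1 by rewrite /= ft1.
    by rewrite E /= => t10; apply: an0; move: ft1; rewrite t10 rmorph0 => -[].
  apply/seteqP; split=> [x [/= Sx]|_ ->]; last by split=> //=; rewrite rmorph0.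
  by rewrite -(SubK R Sx) fval /= => ->; rewrite rmorph0.
have tt2 : tt [set t | (f t).2 = 0].
  split=> // [E|].
    have : [set t | (f t).2 = 0] t2 by rewrite /= ft2.
    by rewrite E /= => t20; apply: an0; move: ft2; rewrite t20 rmorph0 => -[].
  apply/seteqP; split=> [x [/= Sx]|_ ->]; last by split=> //=; rewrite rmorph0.
  by rewrite -(SubK R Sx) fval /= => ->; rewrite rmorph0.
have tt12 : [set t | (f t).1 = 0] <> [set t | (f t).2 = 0].
  move=> E; have : [set t | (f t).1 = 0] t1 by rewrite /= ft1.
  by rewrite E /= ft1.
have /card_eq_I2P : exists I J, I <> J /\
    [set [set t | (f t).1 = 0]; [set t | (f t).2 = 0]] = [set I; J].
  by exists [set t | (f t).1 = 0], [set t | (f t).2 = 0].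
rewrite card_eq_le => /andP[_ /card_le_trans]; apply.
by apply: subset_card_le => I [] ->.
Qed.

End MaximalSubring.

Theorem proposition2p9 (T : pzRingType) (S : {pred T}) (R : subPzRingType S)
    (primeR : prime_ring R) (maxR : maximal_subring [set` S]) :
  [/\ (trivial_trace_ideals [set` S] #<= `I_2)%card,
      (trivial_trace_ideals [set` S] #= `I_2)%card <->
        (exists A : set R, minimal_ideal A /\ iso_diagonal_plus A) &
      (trivial_trace_ideals [set` S] #= `I_2)%card ->
        [/\ minimal_primes T = trivial_trace_ideals [set` S],
            conductor [set` S] = [set 0],
            conductor_l [set` S] = [set 0] &
            conductor_r [set` S] = [set 0]]].
Proof.
split; first exact: (trivial_trace_card_le primeR).
- split=> [/card_eq_I2P[I [J [IJ ttE]]]|[A [[idA An0 _] isoA]]].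
    have ttI : trivial_trace_ideals [set` S] I by rewrite ttE; left.
    have ttJ : trivial_trace_ideals [set` S] J by rewrite ttE; right.
    exists (trace_sum I J).
    by split; [exact: trace_sum_minimal|exact: trace_sum_iso].
  exact: iso_diagonal_plus_card isoA.
- move=> /card_eq_I2P[I [J [IJ ttE]]].
  have ttI : trivial_trace_ideals [set` S] I by rewrite ttE; left.
  have ttJ : trivial_trace_ideals [set` S] J by rewrite ttE; right.
  split.
  + exact: (trivial_trace_minimal_primes primeR maxR ttE IJ).
  + exact: (conductor_eq0 primeR maxR ttI ttJ IJ).
  + exact: (conductor_l_eq0 primeR maxR ttI ttJ IJ).
  + exact: (conductor_r_eq0 primeR maxR ttI ttJ IJ).
Qed.
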